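(* Let $G_1\,{}_\alpha\diamond_\beta\,G_2$ be the doubly warped product of two weighted graphs with warping functions $\alpha:G_2\to(0,\infty)$, $\beta:G_1\to(0,\infty)$, let $x\in G_1$, $p\in G_2$, and let $\mathcal N\in(0,\infty]$. Then $$\mathcal K_{(x,p)}(\mathcal N)\le\min\big\{\alpha^{-2}\mathcal K_{G_1,x}(\mathcal N)+\tfrac12\alpha^2\beta^{-2}\Delta^{G_2}\alpha^{-2},\ \beta^{-2}\mathcal K_{G_2,p}(\mathcal N)+\tfrac12\beta^2\alpha^{-2}\Delta^{G_1}\beta^{-2}\big\}.$$
   Context: A weighted graph $(G,\omega,m)$ consists of a countable vertex set $G$, nonnegative edge weights $\omega_{xy}$, not necessarily symmetric but with $\omega_{xy}=s(x,y)\omega_{yx}$ for some $s(x,y)\neq0$, and a vertex measure $m:G\to(0,\infty)$. Write $x\sim y$ if $\omega_{xy}>0$; every vertex has at least one neighbour and only finitely many. For $f:G\to\mathbb R$, $\Delta f(x)=m(x)^{-1}\sum_{y\sim x}(f(y)-f(x))\omega_{xy}$; $\Gamma(u,v)=\frac12(\Delta(uv)-v\Delta u-u\Delta v)$, $\Gamma_2(u,v)=\frac12(\Delta\Gamma(u,v)-\Gamma(\Delta u,v)-\Gamma(u,\Delta v))$, $\Gamma(f)=\Gamma(f,f)$, $\Gamma_2(f)=\Gamma_2(f,f)$. A superscript $G_i$ indicates the graph in which the operator is taken. For $\mathcal N\in(0,\infty]$ ($\infty^{-1}=0$), $\mathcal K_{G,x}(\mathcal N)$ is the largest $\mathcal K$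 with $\Gamma_2(f)(x)\ge\mathcal N^{-1}(\Delta f(x))^2+\mathcal K\,\Gamma(f)(x)$ for all $f:G\to\mathbb R$. The doubly warped product $G_1\,{}_\alpha\diamond_\beta\,G_2$ of $(G_1,\omega^{G_1},m^{G_1})$ and $(G_2,\omega^{G_2},m^{G_2})$ is the Cartesian product graph on $G_1\times G_2$ with vertex measure $m((x,p))=m^{G_1}(x)m^{G_2}(p)$ and edge weights $\omega_{((x,p),(y,q))}=\delta_{pq}\,m^{G_2}(p)\,\alpha^{-2}(p)\,\omega^{G_1}_{xy}+\delta_{xy}\,m^{G_1}(x)\,\beta^{-2}(x)\,\omega^{G_2}_{pq}$. $\mathcal K_{(x,p)}$ is its curvature function at $(x,p)$. In all formulas $\alpha=\alpha(p)$, $\beta=\beta(x)$, $\Delta^{G_2}\alpha^{-2}$ is evaluated at $p$ and $\Delta^{G_1}\beta^{-2}$ at $x$. *)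

(* Defs.v *)
From HB Require Import structures.
From mathcomp Require Import all_boot all_order all_algebra.
From mathcomp Require Import mathcomp_extra boolp classical_sets functions.
From mathcomp Require Import cardinality fsbigop reals ereal interval_inference.
From mathcomp Require Import finmap lra.

Set Implicit Arguments.
Unset Strict Implicit.
Unset Printing Implicit Defensive.

Import Order.TTheory GRing.Theory Num.Theory.

Local Open Scope classical_set_scope.
Local Open Scope ring_scope.

(* Weights are not assumed symmetric: [weight_scale] only says that [x] and [y]
   are adjacent in one direction iff they are in the other. *)
Record weightedGraph (R : realType) := WeightedGraph {
  vertex :> countType ;
  weight : vertex -> vertex -> R ;
  vmeas : vertex -> R ;
  weight_ge0 : forall x y, 0 <= weight x y ;
  weight_scale : exists s : vertex -> vertex -> R,
    forall x y, s x y != 0 /\ weight x y = s x y * weight y x ;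
  vmeas_gt0 : forall x, 0 < vmeas x ;
  nbrs_neq0 : forall x, [set y | 0 < weight x y] !=set0 ;
  nbrs_finite : forall x, finite_set [set y | 0 < weight x y]
}.

Section Operators.
Variables (R : realType) (G : weightedGraph R).
Implicit Types (f u v : G -> R) (x : G) (N : \bar R) (K : R).

Definition nbrs x : set G := [set y | 0 < weight x y].

Definition Delta f x : R :=
  (vmeas x)^-1 * \sum_(y \in nbrs x) (f y - f x) * weight x y.

Definition Gamma u v x : R :=
  2^-1 * (Delta (fun y => u y * v y) x - v x * Delta u x - u x * Delta v x).

Definition Gamma2 u v x : R :=
  2^-1 * (Delta (Gamma u v) x - Gamma (Delta u) v x - Gamma u (Delta v) x).

(* [N] ranges over ]0, +oo], and [fine N^-1] is 0 for [N = +oo]. *)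
Definition CD N K x : Prop := forall f,
  fine (N^-1)%E * Delta f x ^+ 2 + K * Gamma f f x <= Gamma2 f f x.

(* The largest [K] such that [CD N K x]: see [CD_curvature]. It is +oo only if
   [x] has no neighbour other than itself. *)
Definition curvature x N : \bar R := ereal_sup [set K%:E | K in [set K | CD N K x]].

Lemma Gamma_ge0 f x : 0 <= Gamma f f x.
Proof.
have E (F : G -> R) : \sum_(y \in nbrs x) F y = \sum_(y <- fset_set (nbrs x)) F y.
  by rewrite fsbig_finite//; exact: nbrs_finite.
rewrite /Gamma /Delta !E mulr_ge0 ?invr_ge0//.
rewrite -addrA -opprD -mulrDl -[(f x + f x)]mulr2n -mulr_natl.
rewrite mulrCA -mulrBr mulr_ge0 ?invr_ge0 ?(ltW (vmeas_gt0 x))//.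
rewrite mulr_sumr -sumrB sumr_ge0// => y _.
rewrite mulrA -mulrBl mulr_ge0 ?weight_ge0//.
have := sqr_ge0 (f y - f x); nra.
Qed.

Lemma CD_curvature N K x : CD N K x <-> (K%:E <= curvature x N)%E.
Proof.
split=> [NK|KN f]; first by apply: ereal_sup_ubound; exists K.
set g := Gamma f f x; have [g0|g0] := leP g 0; last first.
  apply/ler_addgt0Pr => e e0.
  have /ereal_sup_gt[_ [L NL <-]] : ((K - e / g)%:E < curvature x N)%E.
    by apply: lt_le_trans KN; rewrite lte_fin ltrBlDr ltrDl divr_gt0.
  rewrite lte_fin => KL; have := NL f; rewrite -/g => H.
  have := KL; rewrite -(ltr_pM2r g0) mulrBl divfK ?gt_eqF//.
  move=> KL'; lra.
have g00 : g = 0 by apply/eqP; rewrite eq_le g0 Gamma_ge0.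
have /ereal_sup_gt[_ [L NL <-]] : ((K - 1)%:E < curvature x N)%E.
  by apply: lt_le_trans KN; rewrite lte_fin; lra.
by have := NL f; rewrite -/g g00 !mulr0.
Qed.

End Operators.

Section WarpedProduct.
Variables (R : realType) (G1 G2 : weightedGraph R).
Variables (alpha : G2 -> {posnum R}) (beta : G1 -> {posnum R}).

Definition warped_weight (a b : G1 * G2) : R :=
  (a.2 == b.2)%:R * vmeas a.2 * (alpha a.2)%:num ^- 2 * weight a.1 b.1 +
  (a.1 == b.1)%:R * vmeas a.1 * (beta a.1)%:num ^- 2 * weight a.2 b.2.

Definition warped_meas (a : G1 * G2) : R := vmeas a.1 * vmeas a.2.

Lemma weight_gt0_sym (G : weightedGraph R) (x y : G) :
  (0 < weight x y) = (0 < weight y x).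
Proof.
have [s hs] := weight_scale G; rewrite !lt_neqAle !weight_ge0 !andbT ![0 == _]eq_sym.
by have [s0 ->] := hs x y; rewrite mulf_eq0 (negbTE s0).
Qed.

Lemma warped_weight_ge0 a b : 0 <= warped_weight a b.
Proof.
by rewrite addr_ge0// !mulr_ge0// ?weight_ge0 ?invr_ge0 ?exprn_ge0// ltW// vmeas_gt0.
Qed.

Lemma warped_weight_gt0 a b : (0 < warped_weight a b) =
  (a.2 == b.2) && (0 < weight a.1 b.1) || (a.1 == b.1) && (0 < weight a.2 b.2).
Proof.
have H (c : bool) (m w : R) (z : {posnum R}) : 0 < m -> 0 <= w ->
    (0 <= c%:R * m * z%:num ^- 2 * w) /\
    ((c%:R * m * z%:num ^- 2 * w == 0) = ~~ (c && (0 < w))).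
  move=> m0 w0; split.
    by rewrite !mulr_ge0// ?invr_ge0 ?exprn_ge0// ltW.
  case: c => /=; rewrite ?mul0r ?eqxx// mul1r mulf_eq0 gt_eqF//=.
    by rewrite lt_neqAle w0 andbT eq_sym negbK.
  by rewrite mulr_gt0// invr_gt0 exprn_gt0.
have [A0 A] := H (a.2 == b.2) _ _ (alpha a.2) (vmeas_gt0 a.2) (weight_ge0 a.1 b.1).
have [B0 B] := H (a.1 == b.1) _ _ (beta a.1) (vmeas_gt0 a.1) (weight_ge0 a.2 b.2).
rewrite lt_neqAle warped_weight_ge0 andbT eq_sym /warped_weight paddr_eq0//.
by rewrite A B -negb_or negbK.
Qed.

Lemma warped_weight_scale : exists s : G1 * G2 -> G1 * G2 -> R, forall a b,
  s a b != 0 /\ warped_weight a b = s a b * warped_weight b a.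
Proof.
have S a b : (warped_weight a b == 0) = (warped_weight b a == 0).
  apply: negb_inj.
  have E c d : (warped_weight c d != 0) = (0 < warped_weight c d).
    by rewrite lt_neqAle warped_weight_ge0 andbT eq_sym.
  rewrite !E !warped_weight_gt0 (eq_sym a.1) (eq_sym a.2).
  by rewrite (weight_gt0_sym a.1) (weight_gt0_sym a.2).
exists (fun a b => if warped_weight b a == 0 then 1
                   else warped_weight a b / warped_weight b a) => a b.
have [ba0|ba0] := eqVneq (warped_weight b a) 0.
  by rewrite oner_eq0 ba0 mulr0; split=> //; apply/eqP; rewrite S ba0.
by rewrite divfK//; split=> //; rewrite mulf_neq0 ?invr_eq0// S.
Qed.

Lemma warped_meas_gt0 a : 0 < warped_meas a.
Proof. by rewrite mulr_gt0 ?vmeas_gt0. Qed.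

Lemma warped_nbrs_neq0 a : [set b | 0 < warped_weight a b] !=set0.
Proof.
have [y xy] := nbrs_neq0 a.1; exists (y, a.2) => /=.
by rewrite warped_weight_gt0 /= eqxx xy.
Qed.

Lemma warped_nbrs_finite a : finite_set [set b | 0 < warped_weight a b].
Proof.
apply: (@sub_finite_set _ _ ((nbrs a.1 `|` [set a.1]) `*` (nbrs a.2 `|` [set a.2]))).
  move=> b /=; rewrite warped_weight_gt0.
  by case/orP => /andP[/eqP-> ?]; split; by [left|right].
by apply: finite_setX; rewrite finite_setU; split=> //; exact: nbrs_finite.
Qed.

Definition warped_product : weightedGraph R :=
  @WeightedGraph R (G1 * G2)%type warped_weight warped_meas warped_weight_ge0
    warped_weight_scale warped_meas_gt0 warped_nbrs_neq0 warped_nbrs_finite.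

End WarpedProduct.

(* Main.v *)
Require Import Defs.
From HB Require Import structures.
From mathcomp Require Import all_boot all_order all_algebra.
From mathcomp Require Import mathcomp_extra boolp classical_sets functions.
From mathcomp Require Import cardinality fsbigop reals ereal interval_inference.
From mathcomp Require Import ring.

Set Implicit Arguments.
Unset Strict Implicit.
Unset Printing Implicit Defensive.

Import Order.TTheory GRing.Theory Num.Theory.

Local Open Scope ring_scope.

(** A function pulled back from one factor reduces every operator of the product
    to the operators of that factor, up to the warping function; testing the
    curvature condition of the product on such functions gives the curvature
    condition of the factor.  In [Gamma2] the warping function, constant along
    the factor, contributes only its own Laplacian, times [Gamma] of the
    function. *)

Local Open Scope classical_set_scope.

(** Weights are nonnegative, so they vanish off [nbrs x]. This allows the Laplacians of the product
    and of its factors to be summed over common index sets. *)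
Lemma Delta_widen (R : realType) (G : weightedGraph R) (f : G -> R) (x : G)
    (A : set G) : nbrs x `<=` A ->
  Delta f x = (vmeas x)^-1 * \sum_(y \in A) (f y - f x) * weight x y.
Proof.
move=> xA; congr (_ * _); apply: fsbig_widen => // y [_ /negP].
rewrite -leNgt => xy0; have xy : weight x y = 0.
  by apply/le_anti; rewrite xy0 weight_ge0.
by rewrite /= xy mulr0.
Qed.

Lemma fsum_delta (R : idomainType) (I : choiceType) (A : set I) (i : I)
    (F : I -> R) : A i -> \sum_(j \in A) (i == j)%:R * F j = F i.
Proof.
move=> Ai; rewrite -(fsbig_widen [set i]) ?fsbig_set1 ?eqxx ?mul1r// => [j ->//|].
by move=> j [_ /= /eqP]; rewrite eq_sym => /negPf->; rewrite mul0r.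
Qed.

Lemma Delta_cst (R : realType) (G : weightedGraph R) (k : R) (x : G) :
  Delta (fun=> k) x = 0.
Proof. by rewrite /Delta fsbig1 ?mulr0// => y _; rewrite subrr mul0r. Qed.

Lemma DeltaZ (R : realType) (G : weightedGraph R) (k : R) (f : G -> R) (x : G) :
  Delta (fun y => k * f y) x = k * Delta f x.
Proof.
rewrite /Delta mulrCA; congr (_ * _); rewrite mulr_fsumr; apply: eq_fsbigr => y _.
by rewrite mulrA mulrBr.
Qed.

(** An edge of the product moves along one factor only, and the measure of the other factor, present
    in its weight, cancels against [warped_meas]. *)
Lemma Delta_warped (R : realType) (G1 G2 : weightedGraph R)
    (alpha : G2 -> {posnum R}) (beta : G1 -> {posnum R})
    (F : warped_product alpha beta -> R) (x : G1) (p : G2) :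
  Delta F (x, p) = (alpha p)%:num ^- 2 * Delta (fun y => F (y, p)) x +
                   (beta x)%:num ^- 2 * Delta (fun q => F (x, q)) p.
Proof.
(* A neighbour of [(x, p)] keeps one coordinate, so [x] and [p] are added for the box to contain it
   and for the Kronecker deltas to find their index. *)
pose A := nbrs x `|` [set x]; pose B := nbrs p `|` [set p].
have Afin : finite_set A by rewrite finite_setU; split=> //; exact: nbrs_finite.
have Bfin : finite_set B by rewrite finite_setU; split=> //; exact: nbrs_finite.
have xA : A x by right.
have pB : B p by right.
have AB : @nbrs R (warped_product alpha beta) (x, p) `<=` A `*` B.
  move=> [y q]; rewrite /nbrs/= warped_weight_gt0/=.
  by case/orP => /andP[/eqP<- ?]; split; by [left|right].
rewrite (Delta_widen _ AB) (@Delta_widen _ _ _ x A); last by left.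
rewrite (@Delta_widen _ _ _ p B); last by left.
pose wa := vmeas p * (alpha p)%:num ^- 2; pose wb := vmeas x * (beta x)%:num ^- 2.
transitivity ((vmeas x * vmeas p)^-1 * \sum_(z \in A `*` B)
   ((p == z.2)%:R * (wa * ((F (z.1, z.2) - F (x, p)) * weight x z.1)) +
    (x == z.1)%:R * (wb * ((F (z.1, z.2) - F (x, p)) * weight p z.2)))).
  congr (_ * _); apply: eq_fsbigr => -[y q] _ /=.
  by rewrite /warped_weight/= /wa /wb; ring.
rewrite fsbig_split; last exact: finite_setX.
rewrite -(pair_fsbig _ (fun y q =>
  (p == q)%:R * (wa * ((F (y, q) - F (x, p)) * weight x y))))//.
rewrite -(pair_fsbig _ (fun y q =>
  (x == y)%:R * (wb * ((F (y, q) - F (x, p)) * weight p q))))//.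
(* The delta in the second sum fixes the first coordinate, which must become the inner index. *)
rewrite [X in _ * (_ + X)]exchange_fsbig//.
under eq_fsbigr do rewrite fsum_delta//.
under [X in _ * (_ + X)]eq_fsbigr do rewrite fsum_delta//.
rewrite -!mulr_fsumr /wa /wb; field.
by rewrite !gt_eqF ?vmeas_gt0.
Qed.

Lemma GammaC (R : realType) (G : weightedGraph R) (u v : G -> R)
    (x : G) : Gamma u v x = Gamma v u x.
Proof.
by rewrite /Gamma addrAC; under eq_fun do rewrite mulrC.
Qed.

(* The last hypothesis says that [c] is constant along [pi] to first order at
   [z], i.e. [Gamma c (h \o pi) z = 0]. *)
Lemma curvature_pullback (R : realType) (G H : weightedGraph R) (pi : H -> G)
    (c : H -> R) (z : H) (N : \bar R) : 0 < c z ->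
  (forall (g : G -> R) w, Delta (fun v => g (pi v)) w = c w * Delta g (pi w)) ->
  (forall h : G -> R, Delta (fun w => c w * h (pi w)) z =
     c z ^+ 2 * Delta h (pi z) + h (pi z) * Delta c z) ->
  (curvature z N <=
   (c z)%:E * curvature (pi z) N + (2^-1 * (c z)^-1 * Delta c z)%:E)%E.
Proof.
move=> c0 Dpi Dc; apply: ge_ereal_sup => _ [K NK <-].
have Gpi (g h : G -> R) w :
    Gamma (fun v => g (pi v)) (fun v => h (pi v)) w = c w * Gamma g h (pi w).
  by rewrite /Gamma !Dpi (Dpi (fun y => g y * h y)); ring.
(* Both [Delta (c * gh)] and [g * Delta (c * h)] produce the term [g * h * Delta c], and these
   cancel. *)
have Gcpi (g h : G -> R) :
    Gamma (fun v => g (pi v)) (fun v => c v * h (pi v)) z =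
    c z ^+ 2 * Gamma g h (pi z).
  rewrite /Gamma Dpi Dc.
  under [X in Delta X z]eq_fun do rewrite mulrCA.
  by rewrite (Dc (fun y => g y * h y)); ring.
(* The surplus term comes only from [Delta] of [Gamma], which is [c] times a pullback; by [Gcpi] the
   two mixed [Gamma] terms merely scale by [c z ^+ 2]. *)
have G2pi (g : G -> R) :
    Gamma2 (fun v => g (pi v)) (fun v => g (pi v)) z =
    c z ^+ 2 * Gamma2 g g (pi z) + 2^-1 * Gamma g g (pi z) * Delta c z.
  rewrite /Gamma2 (funext (Gpi g g)) (funext (Dpi g)) Dc.
  by rewrite [X in _ - X - _]GammaC Gcpi
    [X in _ = _ * (_ * (_ - X - _)) + _]GammaC; ring.
(* The coefficient of [Gamma g g (pi z)] once the surplus of [G2pi] is moved to the left and the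
   inequality is divided by [c z ^+ 2]. *)
pose L := (c z)^-1 * (K - 2^-1 * (c z)^-1 * Delta c z).
have NL : CD N L (pi z).
  move=> g; have := NK (fun v => g (pi v)); rewrite Gpi Dpi G2pi -lerBlDr => NKg.
  rewrite -(ler_pM2l (exprn_gt0 2 c0)); apply: le_trans NKg.
  by rewrite le_eqVlt (_ : _ == _)//; apply/eqP; rewrite /L; field; rewrite gt_eqF.
rewrite (_ : K = c z * L + 2^-1 * (c z)^-1 * Delta c z); last first.
  by rewrite /L; field; rewrite gt_eqF.
by rewrite EFinD EFinM leeD2r// lee_pmul2l// -CD_curvature.
Qed.

Theorem theorem1p20 (R : realType) (G1 G2 : weightedGraph R)
    (alpha : G2 -> {posnum R}) (beta : G1 -> {posnum R})
    (x : G1) (p : G2) (N : \bar R) (N_gt0 : (0 < N)%E) :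
  let a := (alpha p)%:num in
  let b := (beta x)%:num in
  let Delta_alpha := Delta (fun q : G2 => (alpha q)%:num ^- 2) p in
  let Delta_beta := Delta (fun y : G1 => (beta y)%:num ^- 2) x in
  (@curvature R (warped_product alpha beta) (x, p) N <=
   Order.min
     ((a ^- 2)%:E * curvature x N + (2^-1 * a ^+ 2 * b ^- 2 * Delta_alpha)%:E)
     ((b ^- 2)%:E * curvature p N + (2^-1 * b ^+ 2 * a ^- 2 * Delta_beta)%:E))%E.
Proof.
cbv zeta; set a := (alpha p)%:num; set b := (beta x)%:num.
set Da := Delta _ p; set Db := Delta (fun y : G1 => _) x.
rewrite le_min; apply/andP; split.
(* This factor depends on the second coordinate only, so its Laplacian in the product acquires
   [b ^- 2], while [(c z)^-1] supplies [a ^+ 2]. *)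
- pose c (w : warped_product alpha beta) := (alpha w.2)%:num ^- 2.
  have Dc : Delta c (x, p) = b ^- 2 * Da.
    by rewrite Delta_warped /c/= Delta_cst mulr0 add0r.
  have := @curvature_pullback _ G1 (warped_product alpha beta) fst c (x, p) N.
  rewrite Dc /= /c/= invrK -/a [2^-1 * _ * (_ * Da)]mulrA; apply=> [|g [y q]|h].
  + by rewrite /a invr_gt0 exprn_gt0.
  + by rewrite Delta_warped/= Delta_cst mulr0 addr0.
  (* Along [G1] the warping factor is a scalar, and along [G2] the value [h x] is one. *)
  + rewrite Delta_warped/= DeltaZ.
    under [X in _ + _ * Delta X _]eq_fun do rewrite mulrC.
    by rewrite DeltaZ -/a -/b -/Da; ring.
- pose c (w : warped_product alpha beta) := (beta w.1)%:num ^- 2.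
  have Dc : Delta c (x, p) = a ^- 2 * Db.
    by rewrite Delta_warped /c/= Delta_cst mulr0 addr0.
  have := @curvature_pullback _ G2 (warped_product alpha beta) snd c (x, p) N.
  rewrite Dc /= /c/= invrK -/b [2^-1 * _ * (_ * Db)]mulrA; apply=> [|g [y q]|h].
  + by rewrite /b invr_gt0 exprn_gt0.
  + by rewrite Delta_warped/= Delta_cst mulr0 add0r.
  + rewrite Delta_warped/= DeltaZ.
    under [X in _ * Delta X _ + _ = _]eq_fun do rewrite mulrC.
    by rewrite DeltaZ -/a -/b -/Db; ring.
Qed.
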